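(* Let $A\in\mathbb R^{m\times n}$ and for each $t$ let $\mathcal A_t=\{\mathbf u\in\mathbb R^n: A\mathbf u\ge 0\}$ (componentwise), with negative cone $-\mathcal A_t=\{-\mathbf u:\mathbf u\in\mathcal A_t\}$. Define recursively, backward in $t=T-1,\dots,0$, starting from $a_T^\pm=b_T^\pm=0$: $\widetilde{\mathbf K}_t^+\in\arg\min_{\mathbf K\in\mathcal A_t}F_t^+(\mathbf K)$, $\widetilde{\mathbf K}_t^-\in\arg\min_{\mathbf K\in-\mathcal A_t}F_t^-(\mathbf K)$ (with $F_t^\pm$ built from $a_{t+1}^\pm,b_{t+1}^\pm$), and with $Z_t^\pm=s_t+\mathbf P_t'\widetilde{\mathbf K}_t^\pm$, $a_t^+=\rho_{t+1}\mathbb E[\mathbf P_t]'\widetilde{\mathbf K}_t^++\mathbb E[a_{t+1}^+Z_t^+1_{\{Z_t^+\ge0\}}]+\mathbb E[a_{t+1}^-Z_t^+1_{\{Z_t^+<0\}}]$, $a_t^-=\rho_{t+1}\mathbb E[\mathbf P_t]'\widetilde{\mathbf K}_t^-+\mathbb E[a_{t+1}^+Z_t^-1_{\{Z_t^-\le0\}}]+\mathbb E[a_{t+1}^-Z_t^-1_{\{Z_t^->0\}}]$, $b_t^+=\rho_{t+1}^2(\widetilde{\mathbf K}_t^+)'\mathbb E[\mathbf P_t\mathbf P_t']\widetilde{\mathbf K}_t^++2\rho_{t+1}\mathbb E[a_{t+1}^+Z_t^+\mathbf P_t'\widetilde{\mathbf K}_t^+1_{\{Z_t^+\ge0\}}]+2\rho_{t+1}\mathbb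 E[a_{t+1}^-Z_t^+\mathbf P_t'\widetilde{\mathbf K}_t^+1_{\{Z_t^+<0\}}]+\mathbb E[b_{t+1}^+(Z_t^+)^21_{\{Z_t^+\ge0\}}]+\mathbb E[b_{t+1}^-(Z_t^+)^21_{\{Z_t^+<0\}}]$, $b_t^-=\rho_{t+1}^2(\widetilde{\mathbf K}_t^-)'\mathbb E[\mathbf P_t\mathbf P_t']\widetilde{\mathbf K}_t^-+2\rho_{t+1}\mathbb E[a_{t+1}^+Z_t^-\mathbf P_t'\widetilde{\mathbf K}_t^-1_{\{Z_t^-\le0\}}]+2\rho_{t+1}\mathbb E[a_{t+1}^-Z_t^-\mathbf P_t'\widetilde{\mathbf K}_t^-1_{\{Z_t^->0\}}]+\mathbb E[b_{t+1}^+(Z_t^-)^21_{\{Z_t^-\le0\}}]+\mathbb E[b_{t+1}^-(Z_t^-)^21_{\{Z_t^->0\}}]$. Then the time consistent behavioral portfolio policy of the cone-constrained nested mean-variance problem is, for $t=0,\dots,T-1$, $$\mathbf u_t^{TC}=\widetilde{\mathbf K}_t^+(X_t-\rho_t^{-1}W)1_{\{X_t\ge\rho_t^{-1}W\}}+\widetilde{\mathbf K}_t^-(X_t-\rho_t^{-1}W)1_{\{X_t<\rho_t^{-1}W\}}.$$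
   Context: Market: $T$ periods, one risk-free asset with deterministic gross return $s_t>1$ in period $t$, and $n$ risky assets with random gross return vector $\mathbf e_t$ in period $t$. The excess return vector is $\mathbf P_t=\mathbf e_t-s_t\mathbf 1\in\mathbb R^n$. The vectors $\mathbf P_0,\dots,\mathbf P_{T-1}$ are statistically independent, absolutely continuous, with finite first and second moments, and each covariance matrix $\mathrm{Cov}(\mathbf P_t)=\mathbb E[\mathbf P_t\mathbf P_t']-\mathbb E[\mathbf P_t]\mathbb E[\mathbf P_t]'$ is positive definite. The market is arbitrage-free; in particular, for every nonzero $\mathbf L\in\mathbb R^n$, neither $\mathbf P_t'\mathbf L\le 0$ a.s. nor $\mathbf P_t'\mathbf L\ge 0$ a.s. holds. Write $\rho_t=\prod_{j=t}^{T-1}s_j$ for $t<T$ and $\rho_T=1$. Wealth dynamics: $X_{t+1}=s_tX_t+\mathbf P_t'\mathbf u_t$, where $\mathbf u_t$ is a Markov feedback policy (deterministic function of $X_t$). An investment target $W\in\mathbb R$ is fixed. Behavioral risk aversion: for constants $\gamma_t^+,\gamma_t^-\ge0$, $\gamma_t(X_t)=\gamma_t^+(X_t-\rho_t^{-1}W)$ if $X_t\ge\rho_t^{-1}W$ and $\gamma_t(X_t)=-\gamma_t^-(X_t-\rho_t^{-1}W)$ if $X_t<\rho_t^{-1}W$. Cone-constrained time consistent policy: a Markov policy $(\mathbf u_0^{TC},\dots,\mathbf u_{T-1}^{TC})$ with $\mathbf u_t^{TC}(x)\in\mathcal A_t$ for all $x$ is time consistent if for every $t$ and every wealth level $X_t$,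 $\mathbf u_t^{TC}(X_t)$ minimizes over $\mathbf u_t\in\mathcal A_t$ the objective $\mathrm{Var}(X_T\mid X_t)-\gamma_t(X_t)\mathbb E[X_T\mid X_t]$, where $X_{t+1}=s_tX_t+\mathbf P_t'\mathbf u_t$ and $X_{j+1}=s_jX_j+\mathbf P_j'\mathbf u_j^{TC}(X_j)$ for $j=t+1,\dots,T-1$. Definition of $F_t^\pm:\mathbb R^n\to\mathbb R$, given deterministic numbers $a_{t+1}^\pm,b_{t+1}^\pm,\gamma_t^\pm$, writing $Z=s_t+\mathbf P_t'\mathbf K$: $$F_t^+(\mathbf K)=\rho_{t+1}^2\mathbf K'\mathrm{Cov}(\mathbf P_t)\mathbf K+\mathbb E\big[(2\rho_{t+1}a_{t+1}^++b_{t+1}^+)Z^21_{\{Z\ge0\}}\big]+\mathbb E\big[(2\rho_{t+1}a_{t+1}^-+b_{t+1}^-)Z^21_{\{Z<0\}}\big]-M_+^2-2\rho_{t+1}M_+\,(s_t+\mathbb E[\mathbf P_t]'\mathbf K)-\gamma_t^+M_+-\rho_{t+1}\gamma_t^+(s_t+\mathbb E[\mathbf P_t]'\mathbf K),$$ where $M_+=\mathbb E[a_{t+1}^+Z1_{\{Z\ge0\}}]+\mathbb E[a_{t+1}^-Z1_{\{Z<0\}}]$; and $$F_t^-(\mathbf K)=\rho_{t+1}^2\mathbf K'\mathrm{Cov}(\mathbf P_t)\mathbf K+\mathbb E\big[(2\rho_{t+1}a_{t+1}^++b_{t+1}^+)Z^21_{\{Z\le0\}}\big]+\mathbb E\big[(2\rho_{t+1}a_{t+1}^-+b_{t+1}^-)Z^21_{\{Z>0\}}\big]-M_-^2-2\rho_{t+1}M_-\,(s_t+\mathbb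 E[\mathbf P_t]'\mathbf K)+\gamma_t^-M_-+\rho_{t+1}\gamma_t^-(s_t+\mathbb E[\mathbf P_t]'\mathbf K),$$ where $M_-=\mathbb E[a_{t+1}^+Z1_{\{Z\le0\}}]+\mathbb E[a_{t+1}^-Z1_{\{Z>0\}}]$. *)

(* Defs.v *)
From HB Require Import structures.
From mathcomp Require Import all_boot all_order all_algebra.
From mathcomp Require Import all_classical all_reals all_analysis.
Set Implicit Arguments. Unset Strict Implicit. Unset Printing Implicit Defensive.
Import Order.TTheory GRing.Theory Num.Theory.
Local Open Scope ring_scope.
Local Open Scope classical_set_scope.

Definition dotv (R : realType) (n : nat) (x y : 'cV[R]_n) : R :=
  (x^T *m y) ord0 ord0.

Definition qform (R : realType) (n : nat) (M : 'M[R]_n) (K : 'cV[R]_n) : R :=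
  (K^T *m M *m K) ord0 ord0.

Definition cone (R : realType) (m n : nat) (A : 'M[R]_(m, n)) : set 'cV[R]_n :=
  [set u | forall i : 'I_m, 0 <= (A *m u) i ord0].

Definition negcone (R : realType) (m n : nat) (A : 'M[R]_(m, n)) : set 'cV[R]_n :=
  [set v | exists2 u, cone A u & v = - u].

Definition box (R : realType) (n : nat) (a b : 'I_n -> R) : set 'cV[R]_n :=
  [set x | forall i : 'I_n, a i < x i ord0 <= b i].

Definition borel_n (R : realType) (n : nat) : set (set 'cV[R]_n) :=
  <<s [set B | exists a b : 'I_n -> R, B = box a b] >>.

Definition lebesgue_null (R : realType) (n : nat) (N : set 'cV[R]_n) : Prop :=
  forall e : R, 0 < e ->
    exists a b : nat -> 'I_n -> R,
      [/\ (forall k i, a k i <= b k i),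
          N `<=` \bigcup_k box (a k) (b k) &
          (\sum_(0 <= k <oo) (\prod_(i < n) (b k i - a k i))%:E < e%:E)%E].

Definition Ex d (O : measurableType d) (R : realType) (Pr : probability O R)
  (X : O -> R) : R := fine ('E_Pr[X])%E.

Definition Var d (O : measurableType d) (R : realType) (Pr : probability O R)
  (X : O -> R) : R := fine (variance Pr X).

Definition meanv d (O : measurableType d) (R : realType) (Pr : probability O R)
  (n : nat) (X : O -> 'cV[R]_n) : 'cV[R]_n :=
  \col_i Ex Pr (fun w => X w i ord0).

Definition momM d (O : measurableType d) (R : realType) (Pr : probability O R)
  (n : nat) (X : O -> 'cV[R]_n) : 'M[R]_n :=
  \matrix_(i, j) Ex Pr (fun w => X w i ord0 * X w j ord0).

Definition covM d (O : measurableType d) (R : realType) (Pr : probability O R)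
  (n : nat) (X : O -> 'cV[R]_n) : 'M[R]_n :=
  momM Pr X - meanv Pr X *m (meanv Pr X)^T.

(* mutual independence of the random vectors P_0, ..., P_{T-1}:
   product rule for every family of Borel sets B_0, ..., B_{T-1}
   (taking B_t = R^n recovers every subfamily) *)
Definition indep_vectors d (O : measurableType d) (R : realType)
  (Pr : probability O R) (n T : nat) (P : nat -> O -> 'cV[R]_n) : Prop :=
  forall B : nat -> set 'cV[R]_n, (forall t, (t < T)%N -> @borel_n R n (B t)) ->
  Pr (\bigcap_(t in [set t | (t < T)%N]) (P t @^-1` B t)) =
  (\prod_(t < T) Pr (P t @^-1` B t))%E.

Definition abs_cont_vector d (O : measurableType d) (R : realType)
  (Pr : probability O R) (n : nat) (X : O -> 'cV[R]_n) : Prop :=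
  forall N : set 'cV[R]_n, @borel_n R n N -> lebesgue_null N ->
  Pr (X @^-1` N) = 0%E.

Definition rho (R : realType) (T : nat) (s : nat -> R) (t : nat) : R :=
  \prod_(t <= j < T) s j.

Definition gammaB (R : realType) (T : nat) (s : nat -> R) (W : R)
  (gp gm : nat -> R) (t : nat) (x : R) : R :=
  let c := (rho T s t)^-1 * W in
  if c <= x then gp t * (x - c) else - (gm t * (x - c)).

(* wealth path started at time t from wealth x, using control v at time t
   and the Markov feedback policy u afterwards:
   wealth k = X_{t+k}, X_{j+1} = s_j X_j + P_j' u_j. *)
Fixpoint wealth d (O : measurableType d) (R : realType) (n : nat)
  (s : nat -> R) (P : nat -> O -> 'cV[R]_n) (u : nat -> R -> 'cV[R]_n)
  (t : nat) (x : R) (v : 'cV[R]_n) (k : nat) (w : O) : R :=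
  match k with
  | 0 => x
  | k'.+1 =>
      let y := wealth s P u t x v k' w in
      s (t + k')%N * y +
        dotv (P (t + k')%N w) (if k' is 0 then v else u (t + k')%N y)
  end.

(* objective Var(X_T | X_t = x) - gamma_t(x) E[X_T | X_t = x] when the
   control v is used at time t and the policy u at times t+1, ..., T-1 *)
Definition mv_objective d (O : measurableType d) (R : realType)
  (Pr : probability O R) (n T : nat) (s : nat -> R) (P : nat -> O -> 'cV[R]_n)
  (W : R) (gp gm : nat -> R) (u : nat -> R -> 'cV[R]_n)
  (t : nat) (x : R) (v : 'cV[R]_n) : R :=
  let XT := wealth s P u t x v (T - t) in
  Var Pr XT - gammaB T s W gp gm t x * Ex Pr XT.

Definition time_consistent d (O : measurableType d) (R : realType)
  (Pr : probability O R) (m n T : nat) (A : 'M[R]_(m, n)) (s : nat -> R)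
  (P : nat -> O -> 'cV[R]_n) (W : R) (gp gm : nat -> R)
  (u : nat -> R -> 'cV[R]_n) : Prop :=
  (forall t, (t < T)%N -> forall x : R, cone A (u t x)) /\
  (forall t, (t < T)%N -> forall (x : R) (v : 'cV[R]_n), cone A v ->
     mv_objective Pr T s P W gp gm u t x (u t x)
       <= mv_objective Pr T s P W gp gm u t x v).

(* r = rho_{t+1}, st = s_t, Pt = P_t, ap, am, bp, bm = a_{t+1}^+, a_{t+1}^-,
   b_{t+1}^+, b_{t+1}^-, g = gamma_t^+ (resp. gamma_t^-) *)

Definition Fplus d (O : measurableType d) (R : realType) (Pr : probability O R)
  (n : nat) (r st : R) (Pt : O -> 'cV[R]_n) (ap am bp bm g : R)
  (K : 'cV[R]_n) : R :=
  let Z := fun w => st + dotv (Pt w) K in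
  let M := Ex Pr (fun w => ap * Z w * (0 <= Z w)%R%:R)
         + Ex Pr (fun w => am * Z w * (Z w < 0)%R%:R) in
  let EZ := st + dotv (meanv Pr Pt) K in
  r ^+ 2 * qform (covM Pr Pt) K
  + Ex Pr (fun w => (2 * r * ap + bp) * Z w ^+ 2 * (0 <= Z w)%R%:R)
  + Ex Pr (fun w => (2 * r * am + bm) * Z w ^+ 2 * (Z w < 0)%R%:R)
  - M ^+ 2 - 2 * r * M * EZ - g * M - r * g * EZ.

Definition Fminus d (O : measurableType d) (R : realType) (Pr : probability O R)
  (n : nat) (r st : R) (Pt : O -> 'cV[R]_n) (ap am bp bm g : R)
  (K : 'cV[R]_n) : R :=
  let Z := fun w => st + dotv (Pt w) K in
  let M := Ex Pr (fun w => ap * Z w * (Z w <= 0)%R%:R)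
         + Ex Pr (fun w => am * Z w * (0 < Z w)%R%:R) in
  let EZ := st + dotv (meanv Pr Pt) K in
  r ^+ 2 * qform (covM Pr Pt) K
  + Ex Pr (fun w => (2 * r * ap + bp) * Z w ^+ 2 * (Z w <= 0)%R%:R)
  + Ex Pr (fun w => (2 * r * am + bm) * Z w ^+ 2 * (0 < Z w)%R%:R)
  - M ^+ 2 - 2 * r * M * EZ + g * M + r * g * EZ.

Definition backward_recursion d (O : measurableType d) (R : realType)
  (Pr : probability O R) (m n T : nat) (A : 'M[R]_(m, n)) (s : nat -> R)
  (P : nat -> O -> 'cV[R]_n) (gp gm : nat -> R)
  (ap am bp bm : nat -> R) (Kp Km : nat -> 'cV[R]_n) : Prop :=
  [/\ ap T = 0, am T = 0, bp T = 0, bm T = 0 &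
  forall t, (t < T)%N ->
    let r := rho T s t.+1 in
    let Zp := fun w => s t + dotv (P t w) (Kp t) in
    let Zm := fun w => s t + dotv (P t w) (Km t) in
        (cone A (Kp t) /\
        (forall K, cone A K ->
           Fplus Pr r (s t) (P t) (ap t.+1) (am t.+1) (bp t.+1) (bm t.+1) (gp t) (Kp t)
           <= Fplus Pr r (s t) (P t) (ap t.+1) (am t.+1) (bp t.+1) (bm t.+1) (gp t) K)) /\
        (negcone A (Km t) /\
        (forall K, negcone A K ->
           Fminus Pr r (s t) (P t) (ap t.+1) (am t.+1) (bp t.+1) (bm t.+1) (gm t) (Km t)
           <= Fminus Pr r (s t) (P t) (ap t.+1) (am t.+1) (bp t.+1) (bm t.+1) (gm t) K)) /\
        ap t = r * dotv (meanv Pr (P t)) (Kp t)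
               + Ex Pr (fun w => ap t.+1 * Zp w * (0 <= Zp w)%R%:R)
               + Ex Pr (fun w => am t.+1 * Zp w * (Zp w < 0)%R%:R) /\
        am t = r * dotv (meanv Pr (P t)) (Km t)
               + Ex Pr (fun w => ap t.+1 * Zm w * (Zm w <= 0)%R%:R)
               + Ex Pr (fun w => am t.+1 * Zm w * (0 < Zm w)%R%:R) /\
        bp t = r ^+ 2 * qform (momM Pr (P t)) (Kp t)
               + 2 * r * Ex Pr (fun w => ap t.+1 * Zp w * dotv (P t w) (Kp t) * (0 <= Zp w)%R%:R)
               + 2 * r * Ex Pr (fun w => am t.+1 * Zp w * dotv (P t w) (Kp t) * (Zp w < 0)%R%:R)
               + Ex Pr (fun w => bp t.+1 * Zp w ^+ 2 * (0 <= Zp w)%R%:R)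
               + Ex Pr (fun w => bm t.+1 * Zp w ^+ 2 * (Zp w < 0)%R%:R) /\
        bm t = r ^+ 2 * qform (momM Pr (P t)) (Km t)
               + 2 * r * Ex Pr (fun w => ap t.+1 * Zm w * dotv (P t w) (Km t) * (Zm w <= 0)%R%:R)
               + 2 * r * Ex Pr (fun w => am t.+1 * Zm w * dotv (P t w) (Km t) * (0 < Zm w)%R%:R)
               + Ex Pr (fun w => bp t.+1 * Zm w ^+ 2 * (Zm w <= 0)%R%:R)
               + Ex Pr (fun w => bm t.+1 * Zm w ^+ 2 * (0 < Zm w)%R%:R)].

Definition uTC (R : realType) (n T : nat) (s : nat -> R) (W : R)
  (Kp Km : nat -> 'cV[R]_n) (t : nat) (x : R) : 'cV[R]_n :=
  let c := (rho T s t)^-1 * W in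
  if c <= x then (x - c) *: Kp t else (x - c) *: Km t.

(* Main.v *)
(* Let [y = x - W / rho_t] be the deviation of the wealth from the discounted
   target; it evolves by [y' = s_t y + P_t' u_t], and [uTC] is positively
   homogeneous in [y]. Hence, under [uTC], the terminal deviation is
   [y (rho_t + q_t^+)] for [y >= 0] and [y (rho_t + q_t^-)] for [y < 0], where the
   random variables [q_t^+], [q_t^-] depend only on [P_t, ..., P_{T-1}]. By
   independence, backward induction identifies the first and second moments of
   [q_t^+] and [q_t^-] with [a_t^+], [a_t^-] and [b_t^+], [b_t^-]. With control
   [y K] at time [t] the objective is then [y ^ 2 F_t^+(K)] (if [y > 0]) or
   [y ^ 2 F_t^-(K)] (if [y < 0]) up to a term that does not depend on [K], and
   dividing the cone by [y] gives the cone or its negative. At [y = 0] the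
   objective is a variance, which the zero control annihilates. *)

Require Import Defs.
From HB Require Import structures.
From mathcomp Require Import all_boot all_order all_algebra.
From mathcomp Require Import all_classical all_reals all_analysis.
From mathcomp Require Import measurable_realfun.
From mathcomp Require Import ring lra.
Set Implicit Arguments.
Unset Strict Implicit.
Unset Printing Implicit Defensive.
Import Order.TTheory GRing.Theory Num.Theory.
Import numFieldNormedType.Exports.
Local Open Scope ring_scope.
Local Open Scope classical_set_scope.

(** * Real-valued expectation, and products of independent variables *)

Section Expectation.
Context (d : measure_display) (O : measurableType d) (R : realType)
  (Pr : probability O R).
Implicit Types X Y : O -> R.

Definition integrableR X := Pr.-integrable setT (EFin \o X).

Lemma Ex_Rintegral X : Ex Pr X = \int[Pr]_w X w.
Proof. by rewrite /Ex /Rintegral unlock. Qed.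

Lemma integrableR_measurable X : integrableR X -> measurable_fun setT X.
Proof. by move=> /measurable_int/measurable_EFinP. Qed.

Lemma integrableR_cst (c : R) : integrableR (fun=> c).
Proof. exact: finite_measure_integrable_cst. Qed.

Lemma integrableRD X Y : integrableR X -> integrableR Y ->
  integrableR (fun w => X w + Y w).
Proof. by move=> iX iY; apply: (integrableD measurableT iX iY). Qed.

Lemma integrableRZ (c : R) X : integrableR X -> integrableR (fun w => c * X w).
Proof. by move=> iX; apply: (integrableZl measurableT c iX). Qed.

Lemma integrableR_le X Y : measurable_fun setT X ->
  (forall w, `|X w| <= `|Y w|) -> integrableR Y -> integrableR X.
Proof.
move=> mX XY iY; apply: (le_integrable measurableT _ _ iY).
  exact/measurable_EFinP.
by move=> w _; rewrite /= lee_fin.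
Qed.

Lemma Ex_cst (c : R) : Ex Pr (fun=> c) = c.
Proof. by rewrite /Ex (expectation_cst Pr c). Qed.

Lemma ExD X Y : integrableR X -> integrableR Y ->
  Ex Pr (fun w => X w + Y w) = Ex Pr X + Ex Pr Y.
Proof. by move=> iX iY; rewrite !Ex_Rintegral RintegralD. Qed.

Lemma ExZ (c : R) X : integrableR X -> Ex Pr (fun w => c * X w) = c * Ex Pr X.
Proof. by move=> iX; rewrite !Ex_Rintegral RintegralZl. Qed.

Lemma eq_Ex X Y : X =1 Y -> Ex Pr X = Ex Pr Y.
Proof. by move=> XY; congr Ex; apply/funext. Qed.

Lemma eq_integrableR X Y : X =1 Y -> integrableR X -> integrableR Y.
Proof. by move=> /funext ->. Qed.

Section Independent.
Variables (X Y : O -> R).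
Hypotheses (iX : integrableR X) (iY : integrableR Y).
Hypothesis XY : forall A B : set R, measurable A -> measurable B ->
  Pr (X @^-1` A `&` Y @^-1` B) = (Pr (X @^-1` A) * Pr (Y @^-1` B))%E.

Let mX := integrableR_measurable iX.
Let mY := integrableR_measurable iY.
(** [X], [Y] and the pair [Z] are packed as measurable functions so that their laws can be formed
    with [distribution]. *)
Let fX : {mfun O >-> R} := HB.pack X (isMeasurableFun.Build _ _ _ _ X mX).
Let fY : {mfun O >-> R} := HB.pack Y (isMeasurableFun.Build _ _ _ _ Y mY).
Let Z w := (X w, Y w).
Let mZ : measurable_fun setT Z := measurable_fun_pair mX mY.
Let fZ : {mfun O >-> (R * R)%type} :=
  HB.pack Z (isMeasurableFun.Build _ _ _ _ Z mZ).
Let pX := distribution Pr fX.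
Let pY := distribution Pr fY.

(** By [XY] the two measures agree on measurable rectangles, which determine the product measure. *)
Let joint_distribution A : measurable A ->
  distribution Pr fZ A = (pX \x pY)%E A.
Proof.
move=> mA; symmetry; exact: product_measure_unique.
Qed.

(** Tonelli: transporting the integral to the product law turns it into an iterated integral that
    splits. *)
Let ge0_integral_prod (f g : R -> R) :
  measurable_fun setT f -> measurable_fun setT g ->
  (forall x, 0 <= f x) -> (forall x, 0 <= g x) ->
  (\int[Pr]_w (f (X w) * g (Y w))%:E =
   \int[Pr]_w (f (X w))%:E * \int[Pr]_w (g (Y w))%:E)%E.
Proof.
move=> mf mg f0 g0.
have mfE : measurable_fun setT (EFin \o f) by exact/measurable_EFinP.
have mgE : measurable_fun setT (EFin \o g) by exact/measurable_EFinP.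
have mfg : measurable_fun setT (fun z : R * R => (f z.1 * g z.2)%:E).
  apply/measurable_EFinP; apply: measurable_funM.
    exact: (measurableT_comp mf).
  exact: (measurableT_comp mg).
have -> : (\int[Pr]_w (f (X w) * g (Y w))%:E =
    \int[distribution Pr fZ]_z (f z.1 * g z.2)%:E)%E.
  rewrite ge0_integral_distribution// => z.
  by rewrite lee_fin mulr_ge0.
rewrite (eq_measure_integral (pX \x pY)%E); last first.
  by move=> A mA _; exact: joint_distribution.
rewrite fubini_tonelli1//=; last by move=> z; rewrite lee_fin mulr_ge0.
rewrite /fubini_F/=.
under eq_integral.
  move=> x _; under eq_integral do rewrite EFinM.
  rewrite ge0_integralZl//; last 2 first.
    by move=> y _; rewrite lee_fin.
    by rewrite lee_fin.
  over.
rewrite ge0_integralZr//; first last.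
- by apply: integral_ge0 => y _; rewrite lee_fin.
- by move=> y _; rewrite lee_fin.
rewrite (ge0_integral_distribution fX mfE); last first.
  by move=> y; rewrite lee_fin.
by rewrite (ge0_integral_distribution fY mgE).
Qed.

(** The nonnegative case applied to absolute values: independence takes the place of a
    Cauchy-Schwarz bound. *)
Lemma integrableR_indepM : integrableR (fun w => X w * Y w).
Proof.
apply/integrableP; split.
  by apply/measurable_EFinP; exact: measurable_funM.
under eq_integral do rewrite /= normrM.
rewrite (ge0_integral_prod (f := @Num.norm R R) (g := @Num.norm R R))//.
move/integrableP : iX => [_ X1]; move/integrableP : iY => [_ Y1].
by rewrite lte_mul_pinfty// ?integral_ge0// ge0_fin_numE// integral_ge0.
Qed.

(** Fubini under the product law, once integrability of the product is transported from [Pr] to that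
    law. *)
Lemma Ex_indepM : Ex Pr (fun w => X w * Y w) = Ex Pr X * Ex Pr Y.
Proof.
have mfg : measurable_fun setT (fun z : R * R => (z.1 * z.2)%:E).
  by apply/measurable_EFinP; apply: measurable_funM.
have iZ : Pr.-integrable setT ((fun z : R * R => (z.1 * z.2)%:E) \o fZ).
  exact: integrableR_indepM.
have iW : (pX \x pY)%E.-integrable setT (fun z : R * R => (z.1 * z.2)%:E).
  apply/integrableP; split => //.
  rewrite (eq_measure_integral (distribution Pr fZ)); last first.
    by move=> A mA _; symmetry; exact: joint_distribution.
  rewrite ge0_integral_distribution//; last exact: measurableT_comp.
  by case/integrableP : iZ.
have iYd : pY.-integrable setT (EFin : R -> \bar R).
  apply: integrable_pushforward => //; exact/measurable_EFinP.
have iXd : pX.-integrable setT (EFin : R -> \bar R).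
  apply: integrable_pushforward => //; exact/measurable_EFinP.
have mE : measurable_fun setT (EFin : R -> \bar R) by exact/measurable_EFinP.
have EX : (\int[pX]_x x%:E = \int[Pr]_w (X w)%:E)%E.
  by rewrite (integral_distribution (X := fX) mE).
have EY : (\int[pY]_x x%:E = \int[Pr]_w (Y w)%:E)%E.
  by rewrite (integral_distribution (X := fY) mE).
rewrite /Ex unlock -fineM; try by exact: integrable_fin_num.
congr fine.
rewrite -(integral_distribution (X := fZ) mfg)//.
rewrite (eq_measure_integral (pX \x pY)%E); last first.
  by move=> A mA _; exact: joint_distribution.
rewrite -integral12_prod_meas1// /fubini_F/=.
under eq_integral.
  move=> x _; under eq_integral do rewrite EFinM.
  rewrite integralZl//.
  over.
have fin : (\int[pY]_x x%:E)%E \is a fin_num by exact: integrable_fin_num.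
by rewrite -EX -EY -(fineK fin) integralZr.
Qed.

End Independent.
End Expectation.

(** * Independence extended from pi-systems to the sigma-algebras they generate *)

Section PiLambda.
Context (d : measure_display) (O : measurableType d) (R : realType)
  (Pr : probability O R).

(** The sets [D] that satisfy the product rule with a fixed [E] form a Dynkin system, and it
    contains the pi-system [G]. *)
Lemma indep_generated_l (G : set (set O)) (E : set O) :
  setI_closed G -> G `<=` measurable -> measurable E ->
  (forall D, G D -> Pr (D `&` E) = (Pr D * Pr E)%E) ->
  forall D, <<s G >> D -> Pr (D `&` E) = (Pr D * Pr E)%E.
Proof.
move=> GI Gm mE GE D sD.
have sGm (S : set O) : <<s G >> S -> measurable S.
  by apply: smallest_sub => //; exact: sigma_algebra_measurable.
(* Finiteness lets [Pr E] act as a real factor, in particular when it is pulled out of a series. *)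
have fE : Pr E \is a fin_num by exact: fin_num_measure.
move: D sD.
apply: (@dynkin_induction _ (g_sigma_algebraType G) G
  [set D | Pr (D `&` E) = (Pr D * Pr E)%E]) => //.
- by rewrite /= setTI probability_setT mul1e.
- move=> S /(sGm S) mS /= SE; rewrite probability_setC//.
  rewrite muleBl// ?fin_num_adde_defr// mul1e -SE.
  rewrite setIC -setDE setIC measureD//.
  by rewrite ltey_eq fin_num_measure.
- move=> F mF tF FE /=.
  have mF' k : d.-measurable (F k) by apply: sGm; exact: mF.
  have mFE k : d.-measurable (F k `&` E) by exact: measurableI.
  have tFE : trivIset setT (fun k => F k `&` E) by exact: trivIset_setIr.
  have mUFE : d.-measurable (\bigcup_k (F k `&` E)) by exact: bigcup_measurable.
  have mUF : d.-measurable (\bigcup_k F k) by exact: bigcup_measurable.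
  rewrite setI_bigcupl !measure_semi_bigcup//.
  rewrite muleC -(fineK fE) -nneseriesZl//; apply: eq_eseriesr => k _.
  by rewrite fineK// muleC; exact: FE.
Qed.

(** The one-sided extension is used twice: the outer use varies [D], the inner one varies [E] for
    each generator of [D]. *)
Lemma indep_generated (G H : set (set O)) :
  setI_closed G -> G `<=` measurable -> setI_closed H -> H `<=` measurable ->
  (forall D E, G D -> H E -> Pr (D `&` E) = (Pr D * Pr E)%E) ->
  forall D E, <<s G >> D -> <<s H >> E -> Pr (D `&` E) = (Pr D * Pr E)%E.
Proof.
move=> GI Gm HI Hm GH D E sD sE.
have mE : measurable E.
  by move: E sE; apply: smallest_sub => //; exact: sigma_algebra_measurable.
apply: (indep_generated_l GI) => // D' GD'; rewrite setIC muleC.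
apply: (indep_generated_l HI) => //; first exact: Gm.
by move=> E' HE'; rewrite setIC muleC; exact: GH.
Qed.

End PiLambda.

(** * Sigma-algebras generated by disjoint groups of periods, and their independence *)

Section RandomVectors.
Context (d : measure_display) (O : measurableType d) (R : realType)
  (Pr : probability O R) (n T : nat) (P : nat -> O -> 'cV[R]_n).

Let boxes : set (set 'cV[R]_n) := [set B | exists a b : 'I_n -> R, B = box a b].

(** An open half-space is a countable union of half-open boxes, the generators of [borel_n]. *)
Lemma borel_n_coord (i : 'I_n) :
  measurable_fun setT (fun x : g_sigma_algebraType boxes => x i ord0).
Proof.
apply: (measurability _ (RGenOInfty.measurableE R)) => _ [_ [a ->] <-].
rewrite setTI.
rewrite [X in measurable X](_ : _ = \bigcup_k
    box (fun j => if j == i then a else - k%:R)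
        (fun=> k%:R)); last first.
  apply/seteqP; split=> x /=.
    rewrite in_itv/= andbT => ax.
    (* The sum of absolute values dominates every coordinate, so an integer above it gives one box
       index that serves all coordinates. *)
    pose S := \sum_j `|x j ord0|.
    have S0 : 0 <= S by exact: sumr_ge0.
    have xS j : `|x j ord0| <= S.
      by rewrite /S (bigD1 j)//= lerDl sumr_ge0.
    have /= kS := archi_boundP S0.
    exists (Num.bound S) => // j.
    have := le_lt_trans (xS j) kS; rewrite ltr_norml => /andP[h1 h2].
    by rewrite (ltW h2) andbT; case: eqP => [->|].
  by move=> [k _ /(_ i)]; rewrite eqxx in_itv/= andbT => /andP[].
apply: bigcup_measurable => k _; apply: sub_gen_smallest.
by eexists; eexists.
Qed.

Hypothesis mP : forall t (i : 'I_n), (t < T)%N ->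
  measurable_fun setT (fun w => P t w i ord0).

(** It suffices to treat boxes, whose preimage is a finite intersection of coordinate preimages. *)
Lemma measurable_preimage_borel_n t B : (t < T)%N -> @borel_n R n B ->
  measurable (P t @^-1` B).
Proof.
move=> tT bB; rewrite -[X in measurable X]setTI.
suff : measurable_fun setT (P t : O -> g_sigma_algebraType boxes) by exact.
apply: (measurability _ (erefl : @measurable _ (g_sigma_algebraType boxes) = _)).
move=> _ [_ [a [b ->]] <-]; rewrite setTI.
rewrite [X in measurable X](_ : _ =
   \bigcap_(i in [set: 'I_n]) ((fun w => P t w i ord0) @^-1` `]a i, b i])).
  apply: fin_bigcap_measurable => // i _.
  rewrite -[X in measurable X]setTI; exact: mP.
apply/seteqP; split=> w /=.
  by move=> h i _ /=; rewrite in_itv/=; exact: h.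
by move=> h i; have := h i I; rewrite /= in_itv.
Qed.

(** Events that constrain only periods in [J]; they generate the information carried by [P t] for
    [t] in [J], [t < T]. Free periods get [B t = setT], so that the intersection has the shape
    required by [indep_vectors]. *)
Definition cylinders (J : set nat) : set (set O) :=
  [set D | exists B : nat -> set 'cV[R]_n,
    [/\ forall t, @borel_n R n (B t), forall t, ~ J t -> B t = setT &
        D = \bigcap_(t in [set t | (t < T)%N]) (P t @^-1` B t)]].

Let borel_nT : @borel_n R n setT.
Proof. exact: (@measurableT _ (g_sigma_algebraType boxes)). Qed.

Let borel_nI A B : @borel_n R n A -> @borel_n R n B -> @borel_n R n (A `&` B).
Proof. exact: (@measurableI _ (g_sigma_algebraType boxes)). Qed.

Lemma cylinders_setI J : setI_closed (cylinders J).
Proof.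
move=> _ _ [B [mB BJ ->]] [C [mC CJ ->]]; exists (fun t => B t `&` C t); split.
- by move=> t; exact: borel_nI.
- by move=> t Jt; rewrite BJ// CJ// setTI.
- by rewrite -bigcapI.
Qed.

Lemma cylinders_measurable J : cylinders J `<=` measurable.
Proof.
move=> _ [B [mB _ ->]]; apply: bigcap_measurableType => t tT.
exact: measurable_preimage_borel_n.
Qed.

Lemma measurable_coord_cylinders J t (i : 'I_n) : J t -> (t < T)%N ->
  measurable_fun setT (fun w : g_sigma_algebraType (cylinders J) => P t w i ord0).
Proof.
move=> Jt tT _ A mA; rewrite setTI; apply: sub_gen_smallest.
(* The cylinder constrains the single period [t], through its coordinate [i]. *)
exists (fun s => if s == t then [set x : 'cV[R]_n | A (x i ord0)] else setT).
split.
- move=> s; case: eqP => // _.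
  by rewrite -[X in borel_n X]setTI; exact: (borel_n_coord i).
- by move=> s; case: eqP => // ->.
- apply/seteqP; split=> w /=.
    by move=> Aw s sT /=; case: eqP => // ->.
  by move=> /(_ t tT); rewrite /= eqxx.
Qed.

(** In each period at most one of the two cylinders is constraining, so every factor in the product
    rule for the intersection splits. *)
Lemma cylinders_indep J K : indep_vectors Pr T P -> J `&` K = set0 ->
  forall D E, cylinders J D -> cylinders K E -> Pr (D `&` E) = (Pr D * Pr E)%E.
Proof.
move=> iP JK0 _ _ [B [mB BJ ->]] [C [mC CK ->]].
rewrite -bigcapI (iP (fun t => B t `&` C t)); last first.
  by move=> t _; exact: borel_nI.
rewrite !iP// -big_split/=; apply: eq_bigr => t _.
have [Jt|Jt] := pselect (J t).
  have Kt : ~ K t by move=> Kt; have : (J `&` K) t by []; rewrite JK0.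
  by rewrite CK// setIT preimage_setT probability_setT mule1.
by rewrite BJ// setTI preimage_setT probability_setT mul1e.
Qed.

Lemma indep_cylinder_measurable J K (X Y : O -> R) :
  indep_vectors Pr T P -> J `&` K = set0 ->
  measurable_fun setT (X : g_sigma_algebraType (cylinders J) -> R) ->
  measurable_fun setT (Y : g_sigma_algebraType (cylinders K) -> R) ->
  forall A B : set R, measurable A -> measurable B ->
  Pr (X @^-1` A `&` Y @^-1` B) = (Pr (X @^-1` A) * Pr (Y @^-1` B))%E.
Proof.
move=> iP JK mX mY A B mA mB.
apply: (indep_generated _ _ _ _ (cylinders_indep iP JK)).
- exact: cylinders_setI.
- exact: cylinders_measurable.
- exact: cylinders_setI.
- exact: cylinders_measurable.
- by rewrite -[X in _ X]setTI; exact: mX.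
- by rewrite -[X in _ X]setTI; exact: mY.
Qed.

End RandomVectors.

(** * Measurability with respect to groups of periods *)

Section CylinderInclusion.
Context (d : measure_display) (O : measurableType d) (R : realType)
  (n T : nat) (P : nat -> O -> 'cV[R]_n).

Lemma measurable_cylinders_sub (J K : set nat) (X : O -> R) : J `<=` K ->
  measurable_fun setT (X : g_sigma_algebraType (cylinders T P J) -> R) ->
  measurable_fun setT (X : g_sigma_algebraType (cylinders T P K) -> R).
Proof.
move=> JK mX _ A mA.
have sub : <<s cylinders T P J >> `<=` <<s cylinders T P K >>.
  apply: sub_sigma_algebra2 => _ [B [mB BJ ->]].
  by exists B; split => // t Kt; apply: BJ => /JK.
by apply: sub; exact: mX.
Qed.

Lemma measurable_dotv_cylinders J t (K : 'cV[R]_n) : J t -> (t < T)%N ->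
  measurable_fun setT
    (fun w : g_sigma_algebraType (cylinders T P J) => dotv (P t w) K).
Proof.
move=> Jt tT.
rewrite [X in measurable_fun _ X](_ : _ =
    fun w => \sum_i P t w i ord0 * K i ord0); last first.
  by apply/funext => w; rewrite /dotv mxE; apply: eq_bigr => i _; rewrite mxE.
apply: measurable_sum => i; apply: measurable_funM => //.
exact: measurable_coord_cylinders.
Qed.

End CylinderInclusion.

(** * Square-integrable variables and variance *)

Section SecondMoments.
Context (d : measure_display) (O : measurableType d) (R : realType)
  (Pr : probability O R).
Implicit Types X Y : O -> R.
Local Notation integrableR := (integrableR Pr).

Definition squareint X :=
  measurable_fun setT X /\ integrableR (fun w => X w ^+ 2).

(** Domination by [1 + X ^ 2]. *)
Lemma squareint_integrable X : squareint X -> integrableR X.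
Proof.
move=> [mX iX].
apply: (integrableR_le mX _ (integrableRD (integrableR_cst Pr 1) iX)) => w.
rewrite [leRHS]ger0_norm; last by rewrite addr_ge0// sqr_ge0.
rewrite -[X w ^+ 2]real_normK ?num_real//.
by have := sqr_ge0 (`|X w| - 1); nra.
Qed.

(** Domination by [X ^ 2 + Y ^ 2], since [(|X| - |Y|) ^ 2] is nonnegative. *)
Lemma squareintM X Y : squareint X -> squareint Y ->
  integrableR (fun w => X w * Y w).
Proof.
move=> [mX iX] [mY iY].
apply: (integrableR_le _ _ (integrableRD iX iY)); first exact: measurable_funM.
move=> w; rewrite [leRHS]ger0_norm; last by rewrite addr_ge0// sqr_ge0.
rewrite normrM -[X w ^+ 2]real_normK ?num_real// -[Y w ^+ 2]real_normK ?num_real//.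
by have := sqr_ge0 (`|X w| - `|Y w|); nra.
Qed.

Lemma squareint_cst (c : R) : squareint (fun=> c).
Proof. by split => //; exact: integrableR_cst. Qed.

Lemma squareintZ (c : R) X : squareint X -> squareint (fun w => c * X w).
Proof.
move=> [mX iX]; split; first exact: measurable_funM.
by apply: eq_integrableR (integrableRZ (c ^+ 2) iX) => w; rewrite exprMn.
Qed.

Lemma squareintD X Y : squareint X -> squareint Y ->
  squareint (fun w => X w + Y w).
Proof.
move=> sX sY; have iXY := squareintM sX sY.
move: sX sY => [mX iX] [mY iY]; split; first exact: measurable_funD.
apply: eq_integrableR (integrableRD (integrableRD iX (integrableRZ 2 iXY)) iY).
by move=> w; ring.
Qed.

Lemma squareint_sum (I : Type) (l : seq I) (F : I -> O -> R) :
  (forall i, squareint (F i)) -> squareint (fun w => \sum_(i <- l) F i w).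
Proof.
move=> sF; elim: l => [|i l ih].
  under eq_fun do rewrite big_nil; exact: squareint_cst.
under eq_fun do rewrite big_cons; exact: squareintD.
Qed.

Lemma integrableR_sum (I : Type) (l : seq I) (F : I -> O -> R) :
  (forall i, integrableR (F i)) -> integrableR (fun w => \sum_(i <- l) F i w).
Proof.
move=> sF; elim: l => [|i l ih].
  under eq_fun do rewrite big_nil; exact: integrableR_cst.
under eq_fun do rewrite big_cons; exact: integrableRD.
Qed.

Lemma Ex_sum (I : Type) (l : seq I) (F : I -> O -> R) :
  (forall i, integrableR (F i)) ->
  Ex Pr (fun w => \sum_(i <- l) F i w) = \sum_(i <- l) Ex Pr (F i).
Proof.
move=> sF; elim: l => [|i l ih].
  by under eq_fun do rewrite big_nil; rewrite Ex_cst big_nil.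
under eq_fun do rewrite big_cons; rewrite ExD ?ih ?big_cons//.
exact: integrableR_sum.
Qed.

Lemma squareint_mulb (b : O -> bool) X : measurable_fun setT b ->
  squareint X -> squareint (fun w => X w * (b w)%:R).
Proof.
move=> mb [mX iX].
have mXb : measurable_fun setT (fun w => X w * (b w)%:R).
  rewrite [X in measurable_fun _ X](_ : _ = fun w => if b w then X w else 0).
    exact: measurable_fun_ifT.
  by apply/funext => w; case: (b w); rewrite ?mulr1 ?mulr0.
split=> //; apply: (integrableR_le _ _ iX); first exact: measurable_funX.
by move=> w; case: (b w); rewrite ?mulr1// mulr0 expr0n/= normr0.
Qed.

Lemma Var_ge0 X : 0 <= Var Pr X.
Proof.
rewrite /Var fine_ge0// /variance.
exact: variance_ge0.
Qed.

Lemma Ex_sqr_cstD (c : R) X : squareint X ->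
  Ex Pr (fun w => (c + X w) ^+ 2) =
  c ^+ 2 + 2 * c * Ex Pr X + Ex Pr (fun w => X w ^+ 2).
Proof.
move=> sX; have iX := squareint_integrable sX; have [_ iX2] := sX.
have iC := integrableR_cst Pr (c ^+ 2).
have iZ := integrableRZ (2 * c) iX.
rewrite -[in RHS](Ex_cst Pr (c ^+ 2)) -ExZ// -ExD// -ExD//; last first.
  exact: integrableRD.
by apply: eq_Ex => w; ring.
Qed.

(** The centred square is expanded by [Ex_sqr_cstD] with constant [- Ex Pr X]. *)
Lemma VarE X : squareint X -> Var Pr X = Ex Pr (fun w => X w ^+ 2) - Ex Pr X ^+ 2.
Proof.
move=> sX; pose c := Ex Pr X.
have -> : Var Pr X = Ex Pr (fun w => (- c + X w) ^+ 2).
  rewrite /Var /variance unlock -/(Ex _ _); apply: eq_Ex => w /=.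
  by change ((X w - c) * (X w - c) = (- c + X w) ^+ 2); ring.
by rewrite Ex_sqr_cstD// -/c; ring.
Qed.

End SecondMoments.

(** * Moments of a present variable times a future factor chosen by its sign *)

Section OneStep.
Context (d : measure_display) (O : measurableType d) (R : realType)
  (Pr : probability O R) (n T : nat) (P : nat -> O -> 'cV[R]_n).
Hypothesis mP : forall t (i : 'I_n), (t < T)%N ->
  measurable_fun setT (fun w => P t w i ord0).
Hypothesis iP : indep_vectors Pr T P.
Variables (J K : set nat).
Hypothesis JK : J `&` K = set0.
Local Notation TJ := (g_sigma_algebraType (cylinders T P J)).
Local Notation TK := (g_sigma_algebraType (cylinders T P K)).

Section Step.
Variables (U Qp Qm : O -> R) (r ap am bp bm : R).
Hypotheses (mU : measurable_fun setT (U : TJ -> R))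
  (mQp : measurable_fun setT (Qp : TK -> R))
  (mQm : measurable_fun setT (Qm : TK -> R)).
Hypotheses (sU : squareint Pr U) (sQp : squareint Pr Qp)
  (sQm : squareint Pr Qm).
Hypotheses (Eap : Ex Pr Qp = ap) (Eam : Ex Pr Qm = am).
Hypotheses (Ebp : Ex Pr (fun w => Qp w ^+ 2) = bp)
  (Ebm : Ex Pr (fun w => Qm w ^+ 2) = bm).

(** In the application [U] is the next deviation, [r] is [rho] at the next time, and [Qp], [Qm] are
    the future ratios; [S] is then the terminal deviation. *)
Let S w := U w * (r + if 0 <= U w then Qp w else Qm w).

(** One sign branch at a time: the truncation of [U] depends on the periods in [J] and [r + Q] on
    those in [K], so first and second moments factor. *)
Let truncated_product (b : R -> bool) (Q : O -> R) (a c : R) :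
  measurable_fun setT b -> measurable_fun setT (Q : TK -> R) ->
  squareint Pr Q -> Ex Pr Q = a -> Ex Pr (fun w => Q w ^+ 2) = c ->
  let Ub w := U w * (b (U w))%:R in
  [/\ squareint Pr (fun w => Ub w * (r + Q w)),
      Ex Pr (fun w => Ub w * (r + Q w)) = (r + a) * Ex Pr Ub &
      Ex Pr (fun w => (Ub w * (r + Q w)) ^+ 2) =
        (r ^+ 2 + 2 * r * a + c) * Ex Pr (fun w => Ub w ^+ 2)].
Proof.
move=> mb mQ sQ Ea Ec Ub.
have mUb : measurable_fun setT (Ub : TJ -> R).
  rewrite [X in measurable_fun _ X](_ : _ =
      fun w => if b (U w) then U w else 0).
    by apply: measurable_fun_ifT => //; exact: (measurableT_comp mb mU).
  by apply/funext => w; rewrite /Ub; case: (b (U w)); rewrite ?mulr1 ?mulr0.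
have sUb : squareint Pr Ub.
  by apply: squareint_mulb => //; exact: (measurableT_comp mb sU.1).
have mrQ : measurable_fun setT ((fun w => r + Q w) : TK -> R).
  exact: measurable_funD.
have srQ : squareint Pr (fun w => r + Q w).
  by apply: squareintD => //; exact: squareint_cst.
have mUb2 : measurable_fun setT ((fun w => Ub w ^+ 2) : TJ -> R).
  exact: measurable_funX.
have mrQ2 : measurable_fun setT ((fun w => (r + Q w) ^+ 2) : TK -> R).
  exact: measurable_funX.
have ind1 := indep_cylinder_measurable mP iP JK mUb mrQ.
have ind2 := indep_cylinder_measurable mP iP JK mUb2 mrQ2.
have iQ := squareint_integrable sQ.
have ic := integrableR_cst Pr r.
have eE : (fun w => (Ub w * (r + Q w)) ^+ 2) =
    (fun w => Ub w ^+ 2 * (r + Q w) ^+ 2).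
  by apply/funext => w; rewrite exprMn.
split.
- split; first by apply: measurable_funM; [exact: sUb.1|exact: srQ.1].
  rewrite eE; apply: integrableR_indepM => //; [exact: sUb.2|exact: srQ.2].
- rewrite Ex_indepM//; try exact: squareint_integrable.
  by rewrite ExD// Ex_cst Ea mulrC.
- rewrite eE Ex_indepM//; [|exact: sUb.2|exact: srQ.2].
  by rewrite mulrC Ex_sqr_cstD// Ea Ec.
Qed.

Let mge0 : measurable_fun setT (fun x : R => 0 <= x).
Proof. exact: measurable_fun_ler. Qed.
Let mlt0 : measurable_fun setT (fun x : R => x < 0).
Proof. exact: measurable_fun_ltr. Qed.

Let Up w := U w * (0 <= U w)%R%:R.
Let Um w := U w * (U w < 0)%R%:R.

Let SE : S = fun w => Up w * (r + Qp w) + Um w * (r + Qm w).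
Proof.
apply/funext => w; rewrite /S /Up /Um ltNge.
by case: (0 <= U w); rewrite /= ?mulr1 ?mulr0 ?mul0r ?addr0 ?add0r.
Qed.

(** The cross term vanishes because [Up] and [Um] are never both nonzero. *)
Let S2E : (fun w => S w ^+ 2) =
  fun w => (Up w * (r + Qp w)) ^+ 2 + (Um w * (r + Qm w)) ^+ 2.
Proof.
rewrite SE; apply/funext => w; rewrite /Up /Um ltNge.
by case: (0 <= U w);
  rewrite /= ?mulr1 ?mulr0 ?mul0r ?expr0n/= ?addr0 ?add0r.
Qed.

Let sUp : squareint Pr Up.
Proof.
by apply: squareint_mulb => //; exact: (measurableT_comp mge0 sU.1).
Qed.
Let sUm : squareint Pr Um.
Proof.
by apply: squareint_mulb => //; exact: (measurableT_comp mlt0 sU.1).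
Qed.

Lemma squareint_step : squareint Pr S.
Proof.
rewrite SE; apply: squareintD.
  by have [] := truncated_product mge0 mQp sQp Eap Ebp.
by have [] := truncated_product mlt0 mQm sQm Eam Ebm.
Qed.

Lemma Ex_step : Ex Pr S = r * Ex Pr U +
  (Ex Pr (fun w => ap * U w * (0 <= U w)%R%:R) +
   Ex Pr (fun w => am * U w * (U w < 0)%R%:R)).
Proof.
have [/squareint_integrable ip Ep _] := truncated_product mge0 mQp sQp Eap Ebp.
have [/squareint_integrable im Em _] := truncated_product mlt0 mQm sQm Eam Ebm.
rewrite SE ExD// Ep Em -/Up -/Um.
have -> : Ex Pr U = Ex Pr Up + Ex Pr Um.
  rewrite -ExD; try exact: squareint_integrable.
  apply: eq_Ex => w; rewrite /Up /Um ltNge.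
  by case: (0 <= U w); rewrite /= ?mulr1 ?mulr0 ?addr0 ?add0r.
have -> : Ex Pr (fun w => ap * U w * (0 <= U w)%R%:R) = ap * Ex Pr Up.
  rewrite -ExZ; last exact: squareint_integrable.
  by apply: eq_Ex => w; rewrite mulrA.
have -> : Ex Pr (fun w => am * U w * (U w < 0)%R%:R) = am * Ex Pr Um.
  rewrite -ExZ; last exact: squareint_integrable.
  by apply: eq_Ex => w; rewrite mulrA.
ring.
Qed.

(** The [r ^ 2] shares of both branches recombine into the second moment of [U]; what remains are
    the coefficients [2 * r * a + b] seen in [Fplus] and [Fminus]. *)
Lemma Ex_sqr_step : Ex Pr (fun w => S w ^+ 2) =
  r ^+ 2 * Ex Pr (fun w => U w ^+ 2) +
  Ex Pr (fun w => (2 * r * ap + bp) * U w ^+ 2 * (0 <= U w)%R%:R) +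
  Ex Pr (fun w => (2 * r * am + bm) * U w ^+ 2 * (U w < 0)%R%:R).
Proof.
have [[_ ip] _ Ep] := truncated_product mge0 mQp sQp Eap Ebp.
have [[_ im] _ Em] := truncated_product mlt0 mQm sQm Eam Ebm.
rewrite S2E ExD// Ep Em -/Up -/Um.
have -> : Ex Pr (fun w => U w ^+ 2) =
    Ex Pr (fun w => Up w ^+ 2) + Ex Pr (fun w => Um w ^+ 2).
  rewrite -ExD; [|exact: sUp.2|exact: sUm.2].
  apply: eq_Ex => w; rewrite /Up /Um ltNge.
  by case: (0 <= U w); rewrite /= ?mulr1 ?mulr0 ?expr0n/= ?addr0 ?add0r.
have -> c : Ex Pr (fun w => c * U w ^+ 2 * (0 <= U w)%R%:R) =
    c * Ex Pr (fun w => Up w ^+ 2).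
  rewrite -ExZ; last exact: sUp.2.
  apply: eq_Ex => w; rewrite /Up.
  by case: (0 <= U w); rewrite /= ?mulr1 ?mulr0 ?expr0n/= ?mulr0.
have -> c : Ex Pr (fun w => c * U w ^+ 2 * (U w < 0)%R%:R) =
    c * Ex Pr (fun w => Um w ^+ 2).
  rewrite -ExZ; last exact: sUm.2.
  apply: eq_Ex => w; rewrite /Um.
  by case: (U w < 0); rewrite /= ?mulr1 ?mulr0 ?expr0n/= ?mulr0.
ring.
Qed.

End Step.
End OneStep.

(** * Coordinate formulas for dot products and quadratic forms *)

Section DotProduct.
Context (R : realType) (n : nat).
Implicit Types x y : 'cV[R]_n.

Lemma dotvE x y : dotv x y = \sum_i x i ord0 * y i ord0.
Proof. by rewrite /dotv mxE; apply: eq_bigr => i _; rewrite mxE. Qed.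

Lemma dotvC x y : dotv x y = dotv y x.
Proof. by rewrite !dotvE; apply: eq_bigr => i _; rewrite mulrC. Qed.

Lemma dotvZr (c : R) x y : dotv x (c *: y) = c * dotv x y.
Proof. by rewrite /dotv -scalemxAr mxE. Qed.

Lemma qformE (M : 'M[R]_n) x :
  qform M x = \sum_i \sum_j x i ord0 * x j ord0 * M i j.
Proof.
rewrite /qform mxE exchange_big/=; apply: eq_bigr => j _.
rewrite mxE big_distrl/=; apply: eq_bigr => i _.
by rewrite mxE mulrAC.
Qed.

End DotProduct.

(** * Moments of linear forms of a random vector *)

Section VectorMoments.
Context (d : measure_display) (O : measurableType d) (R : realType)
  (Pr : probability O R) (n : nat) (X : O -> 'cV[R]_n).
Hypothesis sX : forall i, squareint Pr (fun w => X w i ord0).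

Lemma squareint_dotv (k : 'cV[R]_n) : squareint Pr (fun w => dotv (X w) k).
Proof.
under eq_fun do rewrite dotvE; apply: squareint_sum => i.
by under eq_fun do rewrite mulrC; exact: squareintZ.
Qed.

Lemma Ex_dotv (k : 'cV[R]_n) :
  Ex Pr (fun w => dotv (X w) k) = dotv (meanv Pr X) k.
Proof.
have iX i := squareint_integrable (sX i).
under eq_fun do rewrite dotvE; rewrite Ex_sum.
  rewrite dotvE; apply: eq_bigr => i _; rewrite mxE mulrC -ExZ//.
  by apply: eq_Ex => w; rewrite mulrC.
by move=> i; under eq_fun do rewrite mulrC; exact: integrableRZ.
Qed.

Lemma Ex_sqr_dotv (k : 'cV[R]_n) :
  Ex Pr (fun w => dotv (X w) k ^+ 2) = qform (momM Pr X) k.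
Proof.
have iXX i j := squareintM (sX i) (sX j).
rewrite (@eq_Ex _ _ _ _ _ (fun w => \sum_i \sum_j
    k i ord0 * k j ord0 * (X w i ord0 * X w j ord0))); last first.
  move=> w; rewrite dotvE expr2 big_distrl/=; apply: eq_bigr => i _.
  by rewrite big_distrr/=; apply: eq_bigr => j _; ring.
rewrite Ex_sum; last by move=> i; apply: integrableR_sum => j; exact: integrableRZ.
rewrite qformE; apply: eq_bigr => i _.
rewrite Ex_sum; last by move=> j; exact: integrableRZ.
by apply: eq_bigr => j _; rewrite ExZ// mxE.
Qed.

Lemma qform_covM (k : 'cV[R]_n) :
  qform (covM Pr X) k = qform (momM Pr X) k - dotv (meanv Pr X) k ^+ 2.
Proof.
rewrite /covM /qform mulmxBr mulmxBl mxE; congr (_ + _).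
rewrite mxE; congr (- _); rewrite expr2.
have -> : k^T *m (meanv Pr X *m (meanv Pr X)^T) *m k =
    (k^T *m meanv Pr X) *m ((meanv Pr X)^T *m k) by rewrite !mulmxA.
rewrite mxE big_ord1 -/(dotv k (meanv Pr X)) -/(dotv (meanv Pr X) k).
by rewrite [dotv k _]dotvC.
Qed.

End VectorMoments.

(** * One period with control [y *: k], for both signs of [y] at once *)

Section ScaledStep.
Context (d : measure_display) (O : measurableType d) (R : realType)
  (Pr : probability O R) (n T : nat) (P : nat -> O -> 'cV[R]_n).
Hypothesis sP : forall t (i : 'I_n), (t < T)%N ->
  squareint Pr (fun w => P t w i ord0).
Hypothesis iP : indep_vectors Pr T P.
Variables (t : nat) (Qp Qm : O -> R) (r ap am bp bm st : R) (k : 'cV[R]_n).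
Hypothesis tT : (t < T)%N.
Local Notation future :=
  (g_sigma_algebraType (cylinders T P [set j | (t < j)%N])).
Hypotheses (mQp : measurable_fun setT (Qp : future -> R))
  (mQm : measurable_fun setT (Qm : future -> R)).
Hypotheses (sQp : squareint Pr Qp) (sQm : squareint Pr Qm).
Hypotheses (Eap : Ex Pr Qp = ap) (Eam : Ex Pr Qm = am).
Hypotheses (Ebp : Ex Pr (fun w => Qp w ^+ 2) = bp)
  (Ebm : Ex Pr (fun w => Qm w ^+ 2) = bm).

Let mP j (i : 'I_n) : (j < T)%N ->
  measurable_fun setT (fun w => P j w i ord0).
Proof. by move=> jT; exact: (sP i jT).1. Qed.

Let disj : [set t] `&` [set j | (t < j)%N] = set0.
Proof. by apply/seteqP; split=> j //= [-> ]; rewrite ltnn. Qed.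

Let D w := dotv (P t w) k.
Let Z w := st + D w.

Let sD : squareint Pr D.
Proof. by apply: squareint_dotv => i; exact: sP. Qed.

Let sZ : squareint Pr Z.
Proof. by apply: squareintD => //; exact: squareint_cst. Qed.

Let Ex_Z : Ex Pr Z = st + dotv (meanv Pr (P t)) k.
Proof.
rewrite ExD; [|exact: integrableR_cst|exact: squareint_integrable].
by rewrite Ex_cst Ex_dotv// => i; exact: sP.
Qed.

Let Ex_sqr_Z : Ex Pr (fun w => Z w ^+ 2) =
  st ^+ 2 + 2 * st * dotv (meanv Pr (P t)) k + qform (momM Pr (P t)) k.
Proof.
have sPt i := sP i tT.
by rewrite Ex_sqr_cstD// Ex_dotv// Ex_sqr_dotv.
Qed.

Variables (y : R) (b b' : R -> bool).
Hypotheses (bE : forall z, (0 <= y * z) = b z)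
  (bE' : forall z, (y * z < 0) = b' z).
Hypotheses (mb : measurable_fun setT b) (mb' : measurable_fun setT b').

(** The tests [b] and [b'] are the sign tests of [y * z] expressed on [z]: [0 <= z] and [z < 0] when
    [y > 0], [z <= 0] and [0 < z] when [y < 0]. *)
Let S w := y * Z w * (r + if b (Z w) then Qp w else Qm w).

Let M := Ex Pr (fun w => ap * Z w * (b (Z w))%:R)
       + Ex Pr (fun w => am * Z w * (b' (Z w))%:R).
Let N := Ex Pr (fun w => (2 * r * ap + bp) * Z w ^+ 2 * (b (Z w))%:R)
       + Ex Pr (fun w => (2 * r * am + bm) * Z w ^+ 2 * (b' (Z w))%:R).

Let U w := y * Z w.

Let mU : measurable_fun setT
  (U : g_sigma_algebraType (cylinders T P [set t]) -> R).
Proof.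
apply: measurable_funM => //; apply: measurable_funD => //.
exact: measurable_dotv_cylinders.
Qed.

Let sU : squareint Pr U.
Proof. exact: squareintZ. Qed.

Let SE : S = fun w => U w * (r + if 0 <= U w then Qp w else Qm w).
Proof. by apply/funext => w; rewrite /S /U bE. Qed.

Lemma squareint_scaled_step : squareint Pr S.
Proof.
rewrite SE.
exact: (squareint_step mP iP disj r mU mQp mQm sU sQp sQm Eap Eam Ebp Ebm).
Qed.

Let squareint_trunc (c : R -> bool) : measurable_fun setT c ->
  squareint Pr (fun w => Z w * (c (Z w))%:R).
Proof.
by move=> mc; apply: squareint_mulb => //; exact: (measurableT_comp mc sZ.1).
Qed.

Let Ex_lin (c : R -> bool) a : measurable_fun setT c ->
  Ex Pr (fun w => a * Z w * (c (Z w))%:R) =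
  a * Ex Pr (fun w => Z w * (c (Z w))%:R).
Proof.
move=> mc; rewrite -ExZ; last exact/squareint_integrable/squareint_trunc.
by apply: eq_Ex => w; rewrite mulrA.
Qed.

Let Ex_quad (c : R -> bool) a : measurable_fun setT c ->
  Ex Pr (fun w => a * Z w ^+ 2 * (c (Z w))%:R) =
  a * Ex Pr (fun w => (Z w * (c (Z w))%:R) ^+ 2).
Proof.
move=> mc; rewrite -ExZ; last exact: (squareint_trunc mc).2.
apply: eq_Ex => w.
by case: (c (Z w)); rewrite ?mulr1// !mulr0 expr0n/= mulr0.
Qed.

(** Substituting [D = Z - st] reduces the mixed moment to truncated moments of [Z]. *)
Let Ex_mixed (c : R -> bool) a : measurable_fun setT c ->
  Ex Pr (fun w => a * Z w * D w * (c (Z w))%:R) =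
  a * (Ex Pr (fun w => (Z w * (c (Z w))%:R) ^+ 2)
       - st * Ex Pr (fun w => Z w * (c (Z w))%:R)).
Proof.
move=> mc; have sc := squareint_trunc mc.
have ic := squareint_integrable sc.
rewrite mulrBr mulrA -mulNr -!ExZ//; last exact: sc.2.
rewrite -ExD; [|by apply: integrableRZ; exact: sc.2|exact: integrableRZ].
apply: eq_Ex => w; rewrite /Z.
by case: (c _); rewrite ?mulr1 ?mulr0; ring.
Qed.

Lemma Ex_scaled_step :
  Ex Pr S = y * (r * (st + dotv (meanv Pr (P t)) k) + M).
Proof.
rewrite SE (Ex_step mP iP disj r mU mQp mQm sU sQp sQm Eap Eam Ebp Ebm)//.
rewrite /U ExZ; last exact: squareint_integrable.
rewrite Ex_Z /M.
have -> : Ex Pr (fun w => ap * (y * Z w) * (0 <= y * Z w)%R%:R) =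
    y * Ex Pr (fun w => ap * Z w * (b (Z w))%:R).
  by rewrite Ex_lin// mulrA -Ex_lin//; apply: eq_Ex => w; rewrite bE; ring.
have -> : Ex Pr (fun w => am * (y * Z w) * (y * Z w < 0)%R%:R) =
    y * Ex Pr (fun w => am * Z w * (b' (Z w))%:R).
  by rewrite Ex_lin// mulrA -Ex_lin//; apply: eq_Ex => w; rewrite bE'; ring.
ring.
Qed.

Lemma Ex_sqr_scaled_step : Ex Pr (fun w => S w ^+ 2) =
  y ^+ 2 * (r ^+ 2 * (st ^+ 2 + 2 * st * dotv (meanv Pr (P t)) k
                      + qform (momM Pr (P t)) k) + N).
Proof.
rewrite SE (Ex_sqr_step mP iP disj r mU mQp mQm sU sQp sQm Eap Eam Ebp Ebm)//.
have -> : Ex Pr (fun w => U w ^+ 2) = y ^+ 2 * Ex Pr (fun w => Z w ^+ 2).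
  rewrite -ExZ; last exact: sZ.2.
  by apply: eq_Ex => w; rewrite /U exprMn.
rewrite Ex_sqr_Z /N /U.
have -> a : Ex Pr (fun w => a * (y * Z w) ^+ 2 * (0 <= y * Z w)%R%:R) =
    y ^+ 2 * Ex Pr (fun w => a * Z w ^+ 2 * (b (Z w))%:R).
  by rewrite Ex_quad// mulrA -Ex_quad//; apply: eq_Ex => w; rewrite bE; ring.
have -> a : Ex Pr (fun w => a * (y * Z w) ^+ 2 * (y * Z w < 0)%R%:R) =
    y ^+ 2 * Ex Pr (fun w => a * Z w ^+ 2 * (b' (Z w))%:R).
  by rewrite Ex_quad// mulrA -Ex_quad//; apply: eq_Ex => w; rewrite bE'; ring.
ring.
Qed.

(** The terms in [st] cancel between the second moment of [Z] and its squared mean, leaving the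
    covariance form. The shift by [W] affects only the mean, whence the term free of [k]. *)
Lemma scaled_step_objective (g W : R) :
  Var Pr (fun w => W + S w) - g * y * Ex Pr (fun w => W + S w) =
  y ^+ 2 * (r ^+ 2 * qform (covM Pr (P t)) k + N - M ^+ 2
    - 2 * r * M * (st + dotv (meanv Pr (P t)) k)
    - g * M - r * g * (st + dotv (meanv Pr (P t)) k)) - g * y * W.
Proof.
have sS := squareint_scaled_step; have iS := squareint_integrable sS.
have iW := integrableR_cst Pr W.
rewrite VarE; last by apply: squareintD => //; exact: squareint_cst.
rewrite Ex_sqr_cstD// ExD// Ex_cst Ex_scaled_step Ex_sqr_scaled_step.
rewrite qform_covM; ring.
Qed.

Hypothesis y2 : y ^+ 2 = 1.

(** One step of the ratio recursion; [y = 1] gives the [+] ratio and [y = -1] the [-] ratio. *)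
Let Q w := Z w * (r + if b (Z w) then Qp w else Qm w) - r * st.

(** As [y ^ 2 = 1], multiplying [S] by [y] removes the scale, so the moments of [Q] follow from
    those of [S]. *)
Let QE : Q = fun w => - (r * st) + y * S w.
Proof.
by apply/funext => w; rewrite /Q /S !mulrA -expr2 y2 mul1r addrC.
Qed.

Lemma squareint_ratio : squareint Pr Q.
Proof.
rewrite QE; apply: squareintD; first exact: squareint_cst.
exact/squareintZ/squareint_scaled_step.
Qed.

Lemma Ex_ratio : Ex Pr Q = r * dotv (meanv Pr (P t)) k + M.
Proof.
have iS := squareint_integrable squareint_scaled_step.
rewrite QE ExD; [|exact: integrableR_cst|exact: integrableRZ].
by rewrite Ex_cst ExZ// Ex_scaled_step mulrA -expr2 y2; ring.
Qed.

Lemma Ex_sqr_ratio : Ex Pr (fun w => Q w ^+ 2) =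
  r ^+ 2 * qform (momM Pr (P t)) k
  + 2 * r * Ex Pr (fun w => ap * Z w * D w * (b (Z w))%:R)
  + 2 * r * Ex Pr (fun w => am * Z w * D w * (b' (Z w))%:R)
  + Ex Pr (fun w => bp * Z w ^+ 2 * (b (Z w))%:R)
  + Ex Pr (fun w => bm * Z w ^+ 2 * (b' (Z w))%:R).
Proof.
have sS := squareint_scaled_step; have iS := squareint_integrable sS.
have -> : Ex Pr (fun w => Q w ^+ 2) =
    (r * st) ^+ 2 - 2 * (r * st) * (y * Ex Pr S) + Ex Pr (fun w => S w ^+ 2).
  rewrite QE Ex_sqr_cstD; last exact: squareintZ.
  rewrite ExZ// sqrrN mulrN mulNr; congr (_ + _).
  by apply: eq_Ex => w; rewrite exprMn y2 mul1r.
rewrite Ex_scaled_step Ex_sqr_scaled_step [y * (y * _)]mulrA -expr2 y2 /M /N.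
(* Both sides become polynomials in the first two truncated moments of [Z]. *)
rewrite !Ex_mixed// !Ex_quad// !Ex_lin//; ring.
Qed.

End ScaledStep.

(** Induction on the number [T - t] of periods left. *)
Lemma backward_ind (T : nat) (Q : nat -> Prop) : Q T ->
  (forall t, (t < T)%N -> Q t.+1 -> Q t) -> forall t, (t <= T)%N -> Q t.
Proof.
move=> QT Qstep t tT; rewrite -(subKn tT).
elim: (T - t)%N (leq_subr t T) => [|j ih] jT; first by rewrite subn0.
apply: Qstep; first by rewrite ltn_subrL (leq_ltn_trans _ jT).
by rewrite subnSK//; apply: ih; exact: ltnW.
Qed.

(** * Pathwise form of terminal wealth *)

Section Wealth.
Context (d : measure_display) (O : measurableType d) (R : realType)
  (n T : nat) (s : nat -> R) (P : nat -> O -> 'cV[R]_n) (W : R)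
  (Kp Km : nat -> 'cV[R]_n).
Hypothesis s1 : forall t, (t < T)%N -> 1 < s t.

(* With [j] periods left, started at time [T - j] and run under [uTC], the
   deviation [y] of the wealth from the discounted target becomes
   [y * (rho + q.1)] if [0 <= y] and [y * (rho + q.2)] if [y < 0], where
   [q = dev_ratio_rec j w]. *)
Fixpoint dev_ratio_rec (j : nat) (w : O) : R * R :=
  if j is i.+1 then
    let t := (T - j)%N in
    let r := rho T s t.+1 in
    let q := dev_ratio_rec i w in
    let Zp := s t + dotv (P t w) (Kp t) in
    let Zm := s t + dotv (P t w) (Km t) in
    (Zp * (r + if 0 <= Zp then q.1 else q.2) - r * s t,
     Zm * (r + if Zm <= 0 then q.1 else q.2) - r * s t)
  else (0, 0).

(** Indexed by time, whereas the structural recursion counts the periods left. *)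
Definition dev_ratio t := dev_ratio_rec (T - t).

Lemma dev_ratioT w : dev_ratio T w = (0, 0).
Proof. by rewrite /dev_ratio subnn. Qed.

Lemma dev_ratioE t w : (t < T)%N -> dev_ratio t w =
  let r := rho T s t.+1 in
  let q := dev_ratio t.+1 w in
  let Zp := s t + dotv (P t w) (Kp t) in
  let Zm := s t + dotv (P t w) (Km t) in
  (Zp * (r + if 0 <= Zp then q.1 else q.2) - r * s t,
   Zm * (r + if Zm <= 0 then q.1 else q.2) - r * s t).
Proof.
by move=> tT; rewrite /dev_ratio -(subnSK tT) /= subnSK// subKn// ltnW.
Qed.

Lemma rhoE t : (t < T)%N -> rho T s t = s t * rho T s t.+1.
Proof. by move=> tT; rewrite /rho big_ltn. Qed.

(** [wealth] adds periods at the end; backward induction needs the first period split off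
    instead. *)
Lemma wealthS (u : nat -> R -> 'cV[R]_n) t x v k w :
  wealth s P u t x v k.+1 w =
  let x1 := s t * x + dotv (P t w) v in
  wealth s P u t.+1 x1 (u t.+1 x1) k w.
Proof.
elim: k => [|k ih]; first by rewrite /= addn0.
rewrite [LHS]/= -/(wealth s P u t x v k.+1 w) ih [RHS]/= addnS addSn.
by case: k {ih} => [|k] //=; rewrite addn0.
Qed.

Local Notation u := (uTC T s W Kp Km).
Local Notation dev t x := (x - (rho T s t)^-1 * W).

(** The discounted target grows at the risk-free rate: [s t / rho_t = 1 / rho_{t+1}], where [s t] is
    nonzero because it exceeds 1. *)
Lemma dev_step t x z : (t < T)%N -> dev t.+1 (s t * x + z) = s t * dev t x + z.
Proof.
move=> tT; rewrite (rhoE tT) invfM mulrBr !mulrA mulfV; last first.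
  by rewrite gt_eqF// (lt_trans ltr01)// s1.
by rewrite mul1r addrAC.
Qed.

Lemma wealth_uTC t : (t <= T)%N -> forall x w,
  wealth s P u t x (u t x) (T - t) w = W + dev t x *
    (rho T s t + if 0 <= dev t x then (dev_ratio t w).1 else (dev_ratio t w).2).
Proof.
move: t; apply: backward_ind.
  move=> x w; rewrite subnn dev_ratioT /= if_same addr0 /rho big_geq// mulr1 invr1.
  by rewrite mul1r addrC subrK.
move=> t tT ih x w; rewrite -(subnSK tT) wealthS /= ih dev_step//.
rewrite (dev_ratioE w tT) /= /uTC /= -[_^-1 * W <= x]subr_ge0.
set y := dev t x; set r := rho T s t.+1; set q := dev_ratio t.+1 w.
(* The next deviation is [y * Z], and [rho_t = s t * r] absorbs the [- r * s t] in the ratio. *)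
case: ifPn => y0; rewrite dotvZr -[s t * y]mulrC -mulrDr (rhoE tT) -/r.
  (* The sign of [y * Z] is that of [Z] only for [y > 0]; at [y = 0] both sides reduce to [W]. *)
  have [->|yn0] := eqVneq y 0; first by rewrite !mul0r.
  rewrite pmulr_rge0 ?lt_def ?yn0//; move: (if _ then _ else _) => z; ring.
rewrite -ltNge in y0.
by rewrite nmulr_rge0//; move: (if _ then _ else _) => z; ring.
Qed.

Lemma wealth_control t x v w : (t < T)%N ->
  wealth s P u t x v (T - t) w =
  let y' := s t * dev t x + dotv (P t w) v in
  W + y' * (rho T s t.+1 +
    if 0 <= y' then (dev_ratio t.+1 w).1 else (dev_ratio t.+1 w).2).
Proof.
by move=> tT; rewrite -(subnSK tT) wealthS /= wealth_uTC// dev_step.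
Qed.

End Wealth.

(** * Measurability of sign tests *)

Section MeasurableSigns.
Context (R : realType).

Lemma measurable_ge0 : measurable_fun setT (fun x : R => 0 <= x).
Proof. exact: measurable_fun_ler. Qed.

Lemma measurable_gt0 : measurable_fun setT (fun x : R => 0 < x).
Proof. exact: measurable_fun_ltr. Qed.

Lemma measurable_le0 : measurable_fun setT (fun x : R => x <= 0).
Proof. exact: measurable_fun_ler. Qed.

Lemma measurable_lt0 : measurable_fun setT (fun x : R => x < 0).
Proof. exact: measurable_fun_ltr. Qed.

End MeasurableSigns.

(** * Identification of the moments, and optimality *)

Section TimeConsistency.
Context (d : measure_display) (O : measurableType d) (R : realType)
  (Pr : probability O R) (m n T : nat) (A : 'M[R]_(m, n))
  (s : nat -> R) (P : nat -> O -> 'cV[R]_n) (W : R) (gp gm : nat -> R)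
  (ap am bp bm : nat -> R) (Kp Km : nat -> 'cV[R]_n).
Hypothesis s1 : forall t, (t < T)%N -> 1 < s t.
Hypothesis sP : forall t (i : 'I_n), (t < T)%N ->
  squareint Pr (fun w => P t w i ord0).
Hypothesis iP : indep_vectors Pr T P.
Hypothesis rec : backward_recursion Pr T A s P gp gm ap am bp bm Kp Km.

Local Notation from t := (g_sigma_algebraType (cylinders T P [set j | (t <= j)%N])).
Local Notation q t := (dev_ratio T s P Kp Km t).

(** The induction invariant. Measurability is stated relative to periods from [t] on, which yields
    independence from earlier returns. *)
Definition dev_ratio_moments t :=
  [/\ measurable_fun setT ((fun w => (q t w).1) : from t -> R),
      measurable_fun setT ((fun w => (q t w).2) : from t -> R),
      squareint Pr (fun w => (q t w).1) /\ squareint Pr (fun w => (q t w).2),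
      Ex Pr (fun w => (q t w).1) = ap t /\ Ex Pr (fun w => (q t w).2) = am t &
      Ex Pr (fun w => (q t w).1 ^+ 2) = bp t /\
      Ex Pr (fun w => (q t w).2 ^+ 2) = bm t].

Let sign_pos (y z : R) : 0 < y ->
  ((0 <= y * z) = (0 <= z)) * ((y * z < 0) = (z < 0)).
Proof. by move=> y0; rewrite pmulr_rge0// pmulr_rlt0. Qed.

Let sign_neg (y z : R) : y < 0 ->
  ((0 <= y * z) = (z <= 0)) * ((y * z < 0) = (0 < z)).
Proof. by move=> y0; rewrite nmulr_rge0// nmulr_rlt0. Qed.

(** The recursions for [ap], [am], [bp], [bm] are exactly the moment formulas of the ratio step,
    taken with scale 1 for [+] and -1 for [-]. *)
Lemma dev_ratio_momentsP t : (t <= T)%N -> dev_ratio_moments t.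
Proof.
move: t; apply: backward_ind.
  have [apT amT bpT bmT _] := rec.
  have q1 : (fun w => (q T w).1) = cst 0 by apply/funext => w; rewrite dev_ratioT.
  have q2 : (fun w => (q T w).2) = cst 0 by apply/funext => w; rewrite dev_ratioT.
  split.
  - by rewrite q1; exact: measurable_cst.
  - by rewrite q2; exact: measurable_cst.
  - by rewrite q1 q2; split; exact: squareint_cst.
  - by rewrite q1 q2 apT amT !Ex_cst.
  - rewrite bpT bmT.
    by split; under eq_fun do rewrite dev_ratioT expr0n /=; rewrite Ex_cst.
move=> t tT [mQp mQm [sQp sQm] [Eap Eam] [Ebp Ebm]].
have [_ _ _ _ /(_ t tT)/=] := rec.
move=> [_ [_ [apE [amE [bpE bmE]]]]].
have q1 : (fun w => (q t w).1) = fun w =>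
    (s t + dotv (P t w) (Kp t)) * (rho T s t.+1 +
      if 0 <= s t + dotv (P t w) (Kp t) then (q t.+1 w).1 else (q t.+1 w).2)
    - rho T s t.+1 * s t.
  by apply/funext => w; rewrite dev_ratioE.
have q2 : (fun w => (q t w).2) = fun w =>
    (s t + dotv (P t w) (Km t)) * (rho T s t.+1 +
      if s t + dotv (P t w) (Km t) <= 0 then (q t.+1 w).1 else (q t.+1 w).2)
    - rho T s t.+1 * s t.
  by apply/funext => w; rewrite dev_ratioE.
have /= q1s := congr1 (fun f => Ex Pr (fun w => f w ^+ 2)) q1.
have /= q2s := congr1 (fun f => Ex Pr (fun w => f w ^+ 2)) q2.
have mZ k : measurable_fun setT ((fun w => s t + dotv (P t w) k) : from t -> R).
  by apply: measurable_funD => //; exact: measurable_dotv_cylinders (leqnn t) tT.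
have sub : [set j | (t.+1 <= j)%N] `<=` [set j | (t <= j)%N].
  by move=> j; exact: ltnW.
have mQp' := measurable_cylinders_sub sub mQp.
have mQm' := measurable_cylinders_sub sub mQm.
(* Sign tests for the two scales: [p1], [p2] for 1 and [n1], [n2] for -1. *)
have p1 z : (0 <= 1 * z :> R) = (0 <= z) by rewrite mul1r.
have p2 z : (1 * z < 0 :> R) = (z < 0) by rewrite mul1r.
have n1 z : (0 <= -1 * z :> R) = (z <= 0) by rewrite mulN1r oppr_ge0.
have n2 z : (-1 * z < 0 :> R) = (0 < z) by rewrite mulN1r oppr_lt0.
have one2 : 1 ^+ 2 = 1 :> R by rewrite expr1n.
have mone2 : (-1) ^+ 2 = 1 :> R by rewrite sqrrN expr1n.
have mge := @measurable_ge0 R; have mlt := @measurable_lt0 R.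
have mle := @measurable_le0 R; have mgt := @measurable_gt0 R.
split.
- rewrite q1; apply: measurable_funB => //; apply: measurable_funM => //.
  apply: measurable_funD => //; apply: measurable_fun_ifT => //.
  exact: (measurableT_comp mge (mZ (Kp t))).
- rewrite q2; apply: measurable_funB => //; apply: measurable_funM => //.
  apply: measurable_funD => //; apply: measurable_fun_ifT => //.
  exact: (measurableT_comp mle (mZ (Km t))).
- split.
    rewrite q1; exact: (squareint_ratio sP iP _ _ _ tT mQp mQm sQp sQm Eap Eam Ebp Ebm
      p1 one2).
  rewrite q2; exact: (squareint_ratio sP iP _ _ _ tT mQp mQm sQp sQm Eap Eam Ebp Ebm
    n1 mone2).
- split.
    rewrite q1 apE.
    rewrite (Ex_ratio sP iP _ _ _ tT mQp mQm sQp sQm Eap Eam Ebp Ebm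
      p1 p2 mge mlt one2).
    by rewrite addrA.
  rewrite q2 amE.
  rewrite (Ex_ratio sP iP _ _ _ tT mQp mQm sQp sQm Eap Eam Ebp Ebm
    n1 n2 mle mgt mone2).
  by rewrite addrA.
- split.
    rewrite q1s bpE.
    exact: (Ex_sqr_ratio sP iP _ _ _ tT mQp mQm sQp sQm Eap Eam Ebp Ebm
      p1 p2 mge mlt one2).
  rewrite q2s bmE.
  exact: (Ex_sqr_ratio sP iP _ _ _ tT mQp mQm sQp sQm Eap Eam Ebp Ebm
    n1 n2 mle mgt mone2).
Qed.

Local Notation dev t x := (x - (rho T s t)^-1 * W).
Local Notation u := (uTC T s W Kp Km).
Local Notation obj := (mv_objective Pr T s P W gp gm u).

Lemma mv_objective_pos t x k : (t < T)%N -> 0 < dev t x ->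
  obj t x (dev t x *: k) = dev t x ^+ 2 *
    Fplus Pr (rho T s t.+1) (s t) (P t) (ap t.+1) (am t.+1) (bp t.+1) (bm t.+1)
      (gp t) k - gp t * dev t x * W.
Proof.
move=> tT; set y := dev t x => y0.
have [mQp mQm [sQp sQm] [Eap Eam] [Ebp Ebm]] := dev_ratio_momentsP tT.
have bE z := (sign_pos z y0).1; have bE' z := (sign_pos z y0).2.
have := scaled_step_objective sP iP (rho T s t.+1) (s t) k tT mQp mQm sQp sQm
  Eap Eam Ebp Ebm bE bE' (@measurable_ge0 R) (@measurable_lt0 R) (gp t) W.
rewrite /mv_objective /gammaB -subr_ge0 -/y (ltW y0) => objE.
have -> : wealth s P u t x (y *: k) (T - t) = fun w =>
    W + y * (s t + dotv (P t w) k) * (rho T s t.+1 +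
      if 0 <= s t + dotv (P t w) k then (q t.+1 w).1 else (q t.+1 w).2).
  apply/funext => w; rewrite wealth_control//= -/y dotvZr [s t * y]mulrC.
  by rewrite -mulrDr bE.
by rewrite objE /Fplus/= addrA.
Qed.

(** A negative deviation reverses the sign tests, and the risk aversion is [- gm t] times it; the
    coefficient [- gm t] produces the signs in [Fminus]. *)
Lemma mv_objective_neg t x k : (t < T)%N -> dev t x < 0 ->
  obj t x (dev t x *: k) = dev t x ^+ 2 *
    Fminus Pr (rho T s t.+1) (s t) (P t) (ap t.+1) (am t.+1) (bp t.+1) (bm t.+1)
      (gm t) k + gm t * dev t x * W.
Proof.
move=> tT; set y := dev t x => y0.
have [mQp mQm [sQp sQm] [Eap Eam] [Ebp Ebm]] := dev_ratio_momentsP tT.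
have bE z := (sign_neg z y0).1; have bE' z := (sign_neg z y0).2.
have := scaled_step_objective sP iP (rho T s t.+1) (s t) k tT mQp mQm sQp sQm
  Eap Eam Ebp Ebm bE bE' (@measurable_le0 R) (@measurable_gt0 R) (- gm t) W.
have gE : gammaB T s W gp gm t x = - gm t * y.
  by rewrite /gammaB -subr_ge0 -/y leNgt y0 mulNr.
rewrite /mv_objective gE => objE.
have -> : wealth s P u t x (y *: k) (T - t) = fun w =>
    W + y * (s t + dotv (P t w) k) * (rho T s t.+1 +
      if s t + dotv (P t w) k <= 0 then (q t.+1 w).1 else (q t.+1 w).2).
  apply/funext => w; rewrite wealth_control//= -/y dotvZr [s t * y]mulrC.
  by rewrite -mulrDr bE.
by rewrite objE /Fminus/= addrA !mulrN !mulNr !opprK.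
Qed.

(** Risk aversion vanishes at the target, so only the variance is left; zero control keeps the
    deviation at 0 and terminal wealth at [W]. *)
Lemma mv_objective_target t x : (t < T)%N -> dev t x = 0 ->
  obj t x 0 = 0 /\ forall v, 0 <= obj t x v.
Proof.
move=> tT y0.
have g0 : gammaB T s W gp gm t x = 0.
  by rewrite /gammaB -subr_ge0 y0 lexx mulr0.
split; last by move=> v; rewrite /mv_objective g0 mul0r subr0 Var_ge0.
rewrite /mv_objective g0 mul0r subr0.
have -> : wealth s P u t x 0 (T - t) = cst W.
  apply/funext => w; rewrite wealth_control//= y0 mulr0 add0r.
  by rewrite /dotv mulmx0 mxE mul0r addr0.
rewrite VarE; last exact: squareint_cst.
by rewrite (Ex_cst Pr (W ^+ 2)) (Ex_cst Pr W) subrr.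
Qed.

Lemma coneZ (c : R) v : 0 <= c -> cone A v -> cone A (c *: v).
Proof. by move=> c0 Av i; rewrite -scalemxAr mxE mulr_ge0. Qed.

Lemma uTC_cone t x : (t < T)%N -> cone A (u t x).
Proof.
move=> tT; have [_ _ _ _ /(_ t tT)[[Kc _] [[[k kc Kmk] _] _]]] := rec.
rewrite /uTC -subr_ge0; case: ifPn => [y0|]; first exact: coneZ.
rewrite -ltNge => y0.
(* Two signs cancel: [Km t] is the opposite of a cone element and the deviation is negative. *)
by rewrite Kmk scalerN -scaleNr; apply: coneZ => //; rewrite oppr_ge0 ltW.
Qed.

(** For a nonzero deviation [y], each admissible [v] is [y *: k] with [k] in the cone or its
    negative according to the sign of [y], and [y ^ 2 > 0] preserves the comparison of [Fplus] or
    [Fminus]. *)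
Lemma uTC_optimal t x v : (t < T)%N -> cone A v -> obj t x (u t x) <= obj t x v.
Proof.
move=> tT Av; have [_ _ _ _ /(_ t tT)/= [[_ Kmin] [[_ Kmin'] _]]] := rec.
have [y0|y0|y0] := ltgtP (dev t x) 0.
- have -> : u t x = dev t x *: Km t.
    by rewrite /uTC/= -[_^-1 * W <= x]subr_ge0 leNgt y0.
  have -> : v = dev t x *: ((dev t x)^-1 *: v).
    by rewrite scalerA mulfV ?lt_eqF// scale1r.
  rewrite !mv_objective_neg// lerD2r ler_pM2l; last first.
    by rewrite exprn_even_gt0//= lt_eqF.
  (* Since [y < 0], the cone element behind [y^-1 *: v] is [v] scaled by the nonnegative number
     [- y^-1]. *)
  apply: Kmin'; exists ((- (dev t x)^-1) *: v); last by rewrite scaleNr opprK.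
  by apply: coneZ => //; rewrite oppr_ge0 invr_le0 ltW.
- have -> : u t x = dev t x *: Kp t.
    by rewrite /uTC/= -[_^-1 * W <= x]subr_ge0 ltW.
  have -> : v = dev t x *: ((dev t x)^-1 *: v).
    by rewrite scalerA mulfV ?gt_eqF// scale1r.
  rewrite !mv_objective_pos// lerD2r ler_pM2l; last by rewrite exprn_gt0.
  by apply: Kmin; apply: coneZ => //; rewrite invr_ge0 ltW.
- have -> : u t x = 0 by rewrite /uTC y0 !scale0r if_same.
  by have [-> ->] := mv_objective_target tT y0.
Qed.

End TimeConsistency.

Unset Implicit Arguments.

Theorem theorem2 (d : measure_display) (O : measurableType d) (R : realType)
  (Pr : probability O R) (m n T : nat) (A : 'M[R]_(m, n))
  (s : nat -> R) (P : nat -> O -> 'cV[R]_n) (W : R) (gp gm : nat -> R)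
  (ap am bp bm : nat -> R) (Kp Km : nat -> 'cV[R]_n) :
  (* deterministic risk-free gross returns s_t > 1 *)
  (forall t, (t < T)%N -> 1 < s t) ->
  (* P_t are random vectors with finite first and second moments *)
  (forall t (i : 'I_n), (t < T)%N ->
     measurable_fun setT (fun w => P t w i ord0)) ->
  (forall t (i : 'I_n), (t < T)%N ->
     Pr.-integrable setT (fun w => (P t w i ord0)%:E)) ->
  (forall t (i : 'I_n), (t < T)%N ->
     Pr.-integrable setT (fun w => ((P t w i ord0) ^+ 2)%:E)) ->
  (* statistically independent *)
  indep_vectors Pr T P ->
  (* absolutely continuous *)
  (forall t, (t < T)%N -> abs_cont_vector Pr (P t)) ->
  (* positive definite covariance matrices *)
  (forall t, (t < T)%N -> forall K : 'cV[R]_n, K != 0 ->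
     0 < qform (covM Pr (P t)) K) ->
  (* no arbitrage *)
  (forall t, (t < T)%N -> forall L : 'cV[R]_n, L != 0 ->
     ~ {ae Pr, forall w, dotv (P t w) L <= 0} /\
     ~ {ae Pr, forall w, 0 <= dotv (P t w) L}) ->
  (* behavioral risk aversion parameters *)
  (forall t, 0 <= gp t) -> (forall t, 0 <= gm t) ->
  (* the backward recursion defining Ktilde_t^+-, a_t^+-, b_t^+- *)
  backward_recursion Pr T A s P gp gm ap am bp bm Kp Km ->
  (* conclusion: u^TC is the time consistent policy *)
  time_consistent Pr T A s P W gp gm (uTC T s W Kp Km).
Proof.
move=> s1 mP _ iP2 indP _ _ _ _ _ rec.
(* Measurability and integrable squares make every coordinate square-integrable, the form used by
   the moment lemmas. *)
have sP t (i : 'I_n) : (t < T)%N -> squareint Pr (fun w => P t w i ord0).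
  by move=> tT; split; [exact: mP|exact: iP2].
split=> t tT x; first exact: uTC_cone rec _ _ tT.
by move=> v; exact: uTC_optimal s1 sP indP rec _ _ _ tT.
Qed.
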